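(* Let $k\ge 1$ and $m\geq 1$ be integers, let $\alpha_k$ be the continued fraction $[1;6,3,6,3,\ldots,6,3]$ in which the pair $6,3$ occurs $k-1$ times, let $u_k$ be the coefficient of $x^{k-1}$ in the power series expansion of $\dfrac{1+502x+x^2}{(1-x)(1-398x+x^2)}$, and let $T_{n}=n(n+1)/2$. For $$(a,b,c)=\bigl(1,\ \alpha_k,\ -(1+\alpha_k)\bigr)\quad\text{and}\quad (d,e,f)=(-a,-c,-b),$$ we have $$\sum_{j=1}^m (a+bj+cj^2)(d+ej+fj^2)=T_{m-1}\left(\frac{(1+m)(2-3m^2)}{3(3+2u_k)}+(3+2m)T_{m-1}\right).$$
   Context: $T_n=n(n+1)/2$ is the $n$th triangular number (with $T_0=0$). The number $\alpha_k=[1;\underbrace{6,3,6,3,\ldots,6,3}_{2k-2\text{ numbers}}]$ is a finite simple continued fraction; thus $\alpha_1=1$ and $\alpha_{k+1}=1+\cfrac{1}{6+\cfrac{1}{3+(\alpha_k-1)}}=\dfrac{15+7\alpha_k}{13+6\alpha_k}$ for $k\ge1$. The sequence $u_k$ ($k\ge 1$) begins $u_1=1$, $u_2=901$, $u_3=359101$. *)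

(* Defs.v *)
From mathcomp Require Import all_boot all_order all_algebra.

Set Implicit Arguments.
Unset Strict Implicit.
Unset Printing Implicit Defensive.

Import GRing.Theory.
Local Open Scope ring_scope.

(* [a; s_0, s_1, ..., s_(n-1)] as a finite simple continued fraction. *)
Fixpoint contfrac (a : nat) (s : seq nat) : rat :=
  if s is b :: s' then a%:R + (contfrac b s')^-1 else a%:R.

Definition alpha (k : nat) : rat :=
  contfrac 1 (flatten (nseq k.-1 [:: 6; 3]%N)).

Section SeriesQuotient.
Variable F : fieldType.
Implicit Types p q : {poly F}.

(* The first n coefficients of the formal power series s = p / q, obtained by
   solving q * s = p one coefficient at a time; only meaningful if q`_0 != 0. *)
Fixpoint quot_coefs p q (n : nat) : seq F :=
  if n is n'.+1 then
    let s := quot_coefs p q n' in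
    rcons s ((p`_n' - \sum_(i < n') q`_(n' - i) * s`_i) / q`_0)
  else [::].

Definition quot_coef p q (n : nat) : F := (quot_coefs p q n.+1)`_n.

Lemma size_quot_coefs p q n : size (quot_coefs p q n) = n.
Proof. by elim: n => //= n IHn; rewrite size_rcons IHn. Qed.

Lemma nth_quot_coefs p q n i : (i < n)%N -> (quot_coefs p q n)`_i = quot_coef p q i.
Proof.
elim: n => // n IHn; rewrite ltnS leq_eqVlt => /orP[/eqP->// | lt_in].
by rewrite -IHn //= nth_rcons size_quot_coefs lt_in.
Qed.

(* quot_coef p q is the unique sequence whose Cauchy product with the
   coefficients of q is the sequence of coefficients of p. *)
Lemma quot_coefP p q (s : nat -> F) : q`_0 != 0 ->
  (forall n, \sum_(i < n.+1) q`_(n - i) * s i = p`_n) <-> s =1 quot_coef p q.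
Proof.
move=> q0; have quotE n : quot_coef p q n =
    (p`_n - \sum_(i < n) q`_(n - i) * quot_coef p q i) / q`_0.
  rewrite {1}/quot_coef /= nth_rcons size_quot_coefs ltnn eqxx.
  by congr ((_ - _) / _); apply: eq_bigr => i _; rewrite nth_quot_coefs.
split=> [sP n | sE n].
  elim/ltn_ind: n => n IHn; rewrite quotE -sP big_ord_recr /= subnn addrC.
  under [in X in _ - X]eq_bigr => i _ do rewrite -IHn //.
  by rewrite addrK mulrAC mulfV // mul1r.
rewrite big_ord_recr /= subnn sE [in X in _ + X]quotE [q`_0 * _]mulrC divfK //.
by under eq_bigr => i _ do rewrite sE; rewrite addrC subrK.
Qed.

End SeriesQuotient.

(* The sequence starts at k = 1. *)
Definition u (k : nat) : rat :=
  quot_coef (1 + 502 *: 'X + 'X^2)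
            ((1 - 'X) * (1 - 398 *: 'X + 'X^2)) k.-1.

Definition T (n : nat) : rat := n%:R * (n%:R + 1) / 2.

(* Main.v *)
(* The product of the two quadratics is (j-1)^2 (w j^2 - j - 1) with
   w = alpha_k (1 + alpha_k), so the sum is a polynomial in m that is affine
   in w.  Writing alpha_k = p/q by the recurrence (p, q) |-> (7p + 15q, 6p + 13q),
   the form 2p^2 + 2pq - 5q^2 keeps the value -1, and 5q^2 = 3 + 2 u_k because
   (5q^2 - 3)/2 satisfies the recurrence of the generating function; together
   these give 2w/5 = 1 - 1/(3 + 2 u_k). *)
Require Import Defs.
From mathcomp Require Import all_boot all_order all_algebra.
From mathcomp Require Import ring lra zify.

Import GRing.Theory.
Local Open Scope ring_scope.

Fixpoint alpha_frac (n : nat) : rat * rat :=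
  if n is n'.+1 then
    let: (p, q) := alpha_frac n' in (7 * p + 15 * q, 6 * p + 13 * q)
  else (1, 1).

Lemma alpha_frac_gt0 n : 0 < (alpha_frac n).1 /\ 0 < (alpha_frac n).2.
Proof. by elim: n => //= n; case: (alpha_frac n) => p q /= [p0 q0]; split; lra. Qed.

Lemma alpha_frac_form n :
  let: (p, q) := alpha_frac n in 2 * p ^+ 2 + 2 * p * q - 5 * q ^+ 2 = -1.
Proof. by elim: n => //= n; case: (alpha_frac n) => p q IHn; rewrite -IHn; ring. Qed.

Lemma contfrac_addn a b s : contfrac (a + b) s = a%:R + contfrac b s.
Proof. by case: s => [|c s] /=; rewrite natrD ?addrA. Qed.

Lemma alphaE n : alpha n.+1 = (alpha_frac n).1 / (alpha_frac n).2.
Proof.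
(* Since [3 = 2 + 1], the tail after [1; 6] is [2 + alpha n.+1], which exposes the induction
   hypothesis. *)
elim: n => [|n] //; rewrite /alpha /= -/(flatten _) (contfrac_addn 2 1) => ->.
have := alpha_frac_gt0 n; case: (alpha_frac n) => p q /= [p0 q0].
field; apply/and3P; split; lra.
Qed.

Definition u_den : {poly rat} := (1 - 'X) * (1 - 398 *: 'X + 'X^2).

Lemma coef_u_den i : u_den`_i = nth 0 [:: 1; -399; 399; -1] i.
Proof.
rewrite /u_den mulrBl mul1r coefB coefXM !coefE.
by case: i => [|[|[|[|i]]]]; rewrite /= ?coefE /= ?nth_nil; ring.
Qed.

(** The step matrix of [alpha_frac] has trace 20 and determinant 1, with eigenvalues [t] and [t^-1].
    Squared denominators thus combine powers of [t^2], [1], [t^-2], and [t^2 + t^-2 = 398]: these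
    are the roots behind [u_den]. *)
Lemma uE n : u n.+1 = (5 * (alpha_frac n).2 ^+ 2 - 3) / 2.
Proof.
rewrite /u /= -/u_den; symmetry; move: n.
apply/quot_coefP; first by rewrite coef_u_den.
move=> n; under eq_bigr do rewrite coef_u_den.
case: n => [|[|[|n]]].
- by rewrite !big_ord_recr big_ord0 /= !coefE.
- by rewrite !big_ord_recr big_ord0 /= !coefE.
- by rewrite !big_ord_recr big_ord0 /= !coefE.
(* As [u_den] has degree 3, only the last four terms of the Cauchy product survive. *)
rewrite 4!big_ord_recr big1 => [|i _] /=; last first.
  by rewrite nth_default ?mul0r //=; have := ltn_ord i; lia.
rewrite !subSS !subSn ?leqW // subnn !coefE /=.
by case: (alpha_frac n) => p q /=; field.
Qed.

Lemma alpha_u n :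
  alpha n.+1 * (1 + alpha n.+1) = 5 / 2 * (1 - (3 + 2 * u n.+1)^-1).
Proof.
rewrite alphaE uE; have := alpha_frac_gt0 n; have := alpha_frac_form n.
case: (alpha_frac n) => p q /= form [p0 q0].
have q_neq0 : q != 0 by lra.
have -> : 3 + 2 * ((5 * q ^+ 2 - 3) / 2) = 5 * q ^+ 2 by field.
have -> : p / q * (1 + p / q) = (2 * p ^+ 2 + 2 * p * q) / (2 * q ^+ 2).
  by field.
have -> : 2 * p ^+ 2 + 2 * p * q = 5 * q ^+ 2 - 1 by lra.
by field.
Qed.

(** With [r] standing for the reciprocal of [3 + 2 u], eliminating [r] leaves a polynomial identity
    in [x] and [n], provable by induction on [n] for every [x]. *)
Lemma sum_quadratics (x r : rat) n : x * (1 + x) = 5 / 2 * (1 - r) ->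
  \sum_(1 <= j < n.+2)
     (1 + x * j%:R - (1 + x) * j%:R ^+ 2) * (-1 + (1 + x) * j%:R - x * j%:R ^+ 2) =
  T n * ((1 + n.+1%:R) * (2 - 3 * n.+1%:R ^+ 2) / 3 * r
         + (3 + 2 * n.+1%:R) * T n).
Proof.
move=> xr; have -> : r = 1 - 2 / 5 * (x * (1 + x)) by rewrite xr; field.
elim: n => [|n IHn]; first by rewrite big_nat1 /T; field.
by rewrite big_nat_recr //= IHn /T -!natr1; field.
Qed.

Theorem theorem8 (k m : nat) (hk : (1 <= k)%N) (hm : (1 <= m)%N)
    (a b c d e f : rat)
    (habc : (a, b, c) = (1, alpha k, - (1 + alpha k)))
    (hdef : (d, e, f) = (- a, - c, - b)) :
  \sum_(1 <= j < m.+1)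
     (a + b * j%:R + c * j%:R ^+ 2) * (d + e * j%:R + f * j%:R ^+ 2) =
  T m.-1 * ((1 + m%:R) * (2 - 3 * m%:R ^+ 2) / (3 * (3 + 2 * u k))
            + (3 + 2 * m%:R) * T m.-1).
Proof.
case: k hk habc => // k _ [-> -> ->] in hdef *; case: hdef => -> -> ->.
case: m hm => // m _; rewrite invfM mulrA -(sum_quadratics _ _ _ (alpha_u k)).
by apply: eq_bigr => j _; rewrite opprK !mulNr.
Qed.
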